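(* Let $\Gamma$ be a strongly connected graph with nonnegative weights and at least two vertices. Then $$0\leq 1-\sqrt{1-h^2(\widetilde{\Gamma})}\leq \min_{i\neq 0}\Re(\lambda_i(\Delta(\Gamma)))\leq \max_i\Re(\lambda_i(\Delta(\Gamma)))\leq 1+\sqrt{1-(1-\overline{h}(\widetilde{\Gamma}))^2}\leq 2,$$ where $h(\widetilde{\Gamma})$ and $\overline{h}(\widetilde{\Gamma})$ are the Cheeger constant and the dual Cheeger constant of the graph $\widetilde{\Gamma}$.
   Context: A graph $\Gamma=(V,E,w)$ is a finite weighted directed graph, loops allowed, without multiple edges; $w_{ij}$ is the weight of the directed edge from $j$ to $i$, with $w_{ij}=0$ if and only if there is no such edge. $\Gamma$ is strongly connected if any two distinct vertices are joined by directed paths in both directions. $d_i^{\mathrm{in}}=\sum_j w_{ij}$. The normalized Laplace operator on complex valued functions on $V$ is $\Delta v(i)=v(i)-\frac{1}{d_i^{\mathrm{in}}}\sum_j w_{ij}v(j)$ if $d_i^{\mathrm{in}}\neq 0$ and $\Delta v(i)=0$ otherwise. Its eigenvalues (with algebraic multiplicity) are $\lambda_0,\dots,\lambda_{n-1}$, $n=|V|$, where $\lambda_0=0$ is the eigenvalue corresponding to the constant function. For $\Gamma$ strongly connected with nonnegative weights (and all in-degrees nonzero) let $\phi:V\to(0,\infty)$ be the Perron vector, i.e. a positive function (existing by the Perron–Frobenius theorem) with $\sum_j\frac{w_{ji}}{d_j^{\mathrm{in}}}\phi(j)=\phi(i)$ for all $i\in V$. The graph $\widetilde\Gamma$ is the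 undirected graph on $V$ with nonnegative symmetric weights $\widetilde w_{ij}=\frac{w_{ij}}{d_i^{\mathrm{in}}}\phi(i)+\frac{w_{ji}}{d_j^{\mathrm{in}}}\phi(j)$, $i,j\in V$. For an undirected graph with nonnegative symmetric weights $w_{ij}$ and degrees $d_i=\sum_j w_{ij}$, let $\mathrm{vol}(W)=\sum_{i\in W}d_i$ and $|E(W,W')|=\sum_{k\in W,\,l\in W'}w_{kl}$ for $W,W'\subseteq V$. The Cheeger constant is $h=\min\frac{|E(W,\overline W)|}{\min\{\mathrm{vol}(W),\mathrm{vol}(\overline W)\}}$, the minimum over all $W\subsetneq V$ with $W$ and $\overline W=V\setminus W$ both nonempty. The dual Cheeger constant is $\overline h=\max\frac{2|E(V_1,V_2)|}{\mathrm{vol}(V_1)+\mathrm{vol}(V_2)}$, the maximum over all disjoint nonempty $V_1,V_2\subseteq V$ (with $V_3=V\setminus(V_1\cup V_2)$ possibly empty). *)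

(* Defs.v *)
From HB Require Import structures.
From mathcomp Require Import all_boot all_order all_algebra.
From mathcomp Require Import complex.

Set Implicit Arguments.
Unset Strict Implicit.
Unset Printing Implicit Defensive.

Import Order.TTheory GRing.Theory Num.Theory.
Local Open Scope ring_scope.
Local Open Scope complex_scope.

Section MinMax.
Variable R : realDomainType.

(* The neutral element is itself a member of s, so for s <> [::] these are the
   genuine minimum and maximum. *)
Definition seq_min (s : seq R) : R := \big[Num.min/head 0 s]_(x <- s) x.
Definition seq_max (s : seq R) : R := \big[Num.max/head 0 s]_(x <- s) x.

End MinMax.

Section DirectedGraph.
Variables (R : rcfType) (V : finType).

(* A weighted graph is its weight function; w i j is the weight of the edge
   from j to i, and w i j = 0 means that there is no such edge. *)
Variable w : V -> V -> R.

Definition edge : rel V := [rel j i | w i j != 0].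

Definition strongly_connected : Prop :=
  forall i j : V, i != j -> connect edge i j /\ connect edge j i.

Definition indeg (i : V) : R := \sum_j w i j.

Definition laplace (v : {ffun V -> R[i]}) : {ffun V -> R[i]} :=
  [ffun i => if indeg i != 0
             then v i - (indeg i)%:C^-1 * \sum_j (w i j)%:C * v j
             else 0].

(* The matrix of the Laplace operator in the basis of indicator functions. *)
Definition laplace_mx : 'M[R[i]]_#|V| :=
  \matrix_(i, j) laplace [ffun k => (k == enum_val j)%:R] (enum_val i).

(* lam 0, ..., lam (#|V| - 1) lists the eigenvalues with algebraic
   multiplicity, starting with the eigenvalue 0 of the constant function;
   values of lam beyond this range are irrelevant. *)
Definition laplace_eigenvalues (lam : nat -> R[i]) : Prop :=
  char_poly laplace_mx = \prod_(i < #|V|) ('X - (lam i)%:P) /\ lam 0%N = 0.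

Definition perron_vector (phi : V -> R) : Prop :=
  (forall i, 0 < phi i) /\
  (forall i, \sum_j w j i / indeg j * phi j = phi i).

Definition sym_weight (phi : V -> R) (i j : V) : R :=
  w i j / indeg i * phi i + w j i / indeg j * phi j.

End DirectedGraph.

Section UndirectedGraph.
Variables (R : rcfType) (V : finType) (w : V -> V -> R).
Implicit Types W : {set V}.

Definition vol W : R := \sum_(i in W) indeg w i.

Definition edge_weight W W' : R := \sum_(k in W) \sum_(l in W') w k l.

Definition cheeger : R :=
  seq_min [seq edge_weight W (~: W) / Num.min (vol W) (vol (~: W))
          | W <- enum {set V} & (W != set0) && (~: W != set0)].

Definition dual_cheeger : R :=
  seq_max [seq 2 * edge_weight p.1 p.2 / (vol p.1 + vol p.2)
          | p <- enum {: {set V} * {set V}}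
          & [&& p.1 != set0, p.2 != set0 & [disjoint p.1 & p.2]]].

End UndirectedGraph.

(* Main.v *)
Require Import Defs.
From mathcomp Require Import all_boot all_order all_algebra.
From mathcomp Require Import complex ring lra.

Set Implicit Arguments.
Unset Strict Implicit.
Unset Printing Implicit Defensive.

Import Order.TTheory GRing.Theory Num.Theory.
Local Open Scope ring_scope.
Local Open Scope complex_scope.

(** Write P for the matrix w i j / indeg w i, so that the Laplacian is 1 - P,
    and let W be the symmetrized weight, which has degree 2 phi.

    Spectral reduction. The constant function is a right null vector of 1 - P
    and phi is a left null vector.  Deflating this pair (char_poly_deflate)
    shows that every further entry of the spectrum, a possible second 0
    included, has an eigenfunction v with sum_i phi i * v i = 0.  For real and
    imaginary parts a, b of v, pairing (1 - P) v = l v with phi v^* and taking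
    real parts replaces phi i * P i j by its symmetric part W i j / 2, whence
    D(a) + D(b) = Re l (N(a) + N(b)) (dform_eigen), where D is the Dirichlet
    form of W and N the squared norm weighted by the degrees.  With Q the
    signless form, D + Q = 2 N, so that Q(a) + Q(b) = (2 - Re l) (N(a) + N(b)).
    By the mediant inequality one of a, b alone is a nonzero test function with
    D <= Re l * N, and one with Q <= (2 - Re l) * N.  It remains to bound
    Rayleigh quotients of real functions for the undirected weight W.

    Both bounds come from one inequality for a symmetric weight A with a killing
    rate b at the vertices (cheeger_dirichlet): if the boundary weight plus the
    killing of every set S inside U is at least k times its volume, then
    D(g) <= mu * N(g) for a nonzero g supported in U forces
    1 - sqrt (1 - k^2) <= mu.  Indeed the isoperimetric assumption, summed over
    the level sets of g^2 (coarea), gives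
      k N <= 1/2 sum A |g_i^2 - g_j^2| + sum b g^2,
    and Cauchy-Schwarz bounds the square of the right side by D (2 N - D).

    For the Cheeger constant (cheeger_bound), shift the test function by a
    median and keep its positive or its negative part: the support then has at
    most half of the volume, so the hypothesis holds with b = 0 and k = h.
    For the dual constant (dual_cheeger_bound), take g = |f| and turn every edge
    between vertices where f has the same sign into killing at both of its ends:
    D(g) is then at most Q(f), and the isoperimetric hypothesis with
    k = 1 - hbar is the definition of hbar for the pair of the positive and the
    negative part of S. *)

(** * Deflating a known eigenvalue *)

Section Deflation.

(** Both sides are the determinant of the block matrix (x, u; v, 1) times x,
    computed with column operations that clear either v or u. *)
Lemma det_rank1_update (D : idomainType) n (x : D) (u : 'cV[D]_n) (v : 'rV[D]_n) :
  \det (x%:M - u *m v) * x = x ^+ n * (x - (v *m u) 0 0).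
Proof.
pose M := block_mx x%:M u v (1%:M : 'M_1).
have E1 : M *m block_mx 1%:M 0 (- v) 1%:M = block_mx (x%:M - u *m v) u 0 1%:M.
  by rewrite mulmx_block !mulmx1 !mulmx0 !mul1mx mulmxN subrr !add0r.
have E2 : M *m block_mx 1%:M (- u) 0 x%:M
          = block_mx x%:M 0 v ((x - (v *m u) 0 0)%:M).
  rewrite mulmx_block !mulmx1 !mulmx0 !mul1mx !addr0 mul_scalar_mx mul_mx_scalar.
  by rewrite scalerN addNr mulmxN {1}(mx11_scalar (v *m u)) -!rmorphN -rmorphD addrC.
move: (congr1 determinant E1) (congr1 determinant E2).
rewrite !det_mulmx !(det_ublock, det_lblock) !det1 !det_scalar !expr1 !mulr1 !mul1r.
by move=> <-.
Qed.

Variables (F : fieldType) (n : nat) (A : 'M[F]_n) (e : 'cV[F]_n) (f : 'rV[F]_n).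
Hypotheses (Ae : A *m e = 0) (fA : f *m A = 0) (fe : f *m e = 1%:M).

(** Adding c e f moves the eigenvalue 0 of e to c and leaves the rest of the
    spectrum in place: since A e = 0, 'X times the characteristic matrix of
    A + c e f factors as (X - A) (X - c e f). *)
Lemma char_poly_deflate c :
  char_poly (A + c *: (e *m f)) * 'X = char_poly A * ('X - c%:P).
Proof.
pose eX : 'cV[{poly F}]_n := map_mx polyC (c *: e).
pose fX : 'rV[{poly F}]_n := map_mx polyC f.
have E : char_poly_mx A *m ('X%:M - eX *m fX)
       = 'X *: char_poly_mx (A + c *: (e *m f)).
  rewrite /char_poly_mx mulmxBr mul_mx_scalar mulmxA mulmxBl.
  rewrite !mul_scalar_mx -map_mxM -scalemxAr Ae scaler0 map_mx0 subr0.
  rewrite map_mxD opprD addrA -scalemxAl -!scalerBr.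
  by rewrite -[in X in _ - X]map_mxM -scalemxAl.
have := congr1 determinant E; rewrite det_mulmx detZ => Ed.
have := det_rank1_update 'X eX fX.
have -> : (fX *m eX) 0 0 = c%:P.
  by rewrite -map_mxM -scalemxAr fe !mxE mulr1.
move=> Er; have Xn0 : 'X ^+ n != 0 :> {poly F} by rewrite expf_neq0 ?polyX_eq0.
apply: (mulfI Xn0).
by rewrite mulrA -Ed -mulrA Er mulrCA.
Qed.

(** An eigenvector of A for x = 0 may lie outside the kernel of f, as e does.
    The one wanted is an eigenvector of a deflation of A. *)
Lemma deflated_eigenvector q x : char_poly A = 'X * q -> root q x ->
  exists2 u : 'cV[F]_n, u != 0 & A *m u = x *: u /\ f *m u = 0.
Proof.
move=> Aq qx.
(* The eigenvalue 0 is moved to x + 1, away from x: f B = (x + 1) f then forces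
   f to vanish on eigenvectors of B for x. *)
pose B := A + (x + 1) *: (e *m f).
have : root (char_poly B) x.
  have := char_poly_deflate (x + 1); rewrite Aq -mulrA mulrC => /mulfI.
  by rewrite polyX_eq0 => /(_ isT) ->; rewrite rootM qx.
have <- : char_poly B^T = char_poly B.
  by rewrite /char_poly -det_tr /char_poly_mx linearB /= tr_scalar_mx map_trmx trmxK.
rewrite -eigenvalue_root_char => /eigenvalueP[v vB vn0].
have Bv : B *m v^T = x *: v^T by rewrite -[B]trmxK -trmx_mul vB linearZ.
exists v^T; first by rewrite -(inj_eq (can_inj (@trmxK _ _ _))) trmxK trmx0.
have fB : f *m B = (x + 1) *: f.
  by rewrite mulmxDr fA add0r -scalemxAr mulmxA fe mul1mx.
have fv : f *m v^T = 0.
  have : f *m B *m v^T = x *: (f *m v^T) by rewrite -mulmxA Bv -scalemxAr.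
  rewrite fB -scalemxAl scalerDl scale1r => /eqP.
  by rewrite -subr_eq0 addrAC subrr add0r => /eqP.
split=> //; rewrite -Bv mulmxDl -scalemxAl -mulmxA fv mulmx0 scaler0 addr0 //.
Qed.

End Deflation.

(** * Extrema of a list, and two elementary inequalities *)

Section SeqMinMax.
Variable R : realDomainType.
Implicit Types (s : seq R) (x c : R).

Lemma seq_min_le s x : x \in s -> seq_min s <= x.
Proof. by move=> xs; apply: bigmin_inf_seq xs _ _. Qed.

Lemma le_seq_max s x : x \in s -> x <= seq_max s.
Proof. by move=> xs; apply: bigmax_sup_seq xs _ _. Qed.

Lemma head_mem s : s != [::] -> head 0 s \in s.
Proof. by case: s => // x s _; rewrite mem_head. Qed.

Lemma le_seq_min s c : s != [::] -> (forall x, x \in s -> c <= x) ->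
  c <= seq_min s.
Proof.
move=> /head_mem s0 cs; rewrite /seq_min big_seq.
apply: (big_ind (fun y => c <= y)) => [|x y cx cy|x]; [exact: cs| |exact: cs].
by rewrite le_min cx cy.
Qed.

Lemma seq_max_le s c : s != [::] -> (forall x, x \in s -> x <= c) ->
  seq_max s <= c.
Proof.
move=> /head_mem s0 cs; rewrite /seq_max big_seq.
apply: (big_ind (fun y => y <= c)) => [|x y cx cy|x]; [exact: cs| |exact: cs].
by rewrite ge_max cx cy.
Qed.

End SeqMinMax.

(** Cauchy-Schwarz in a form that only asks for a termwise use of
    2 t x y <= t^2 x^2 + y^2. *)
Lemma quadratic_bound (R : realFieldType) (D X F : R) :
  (forall t, 2 * t * X <= t ^+ 2 * D + F) -> 0 <= D -> X ^+ 2 <= D * F.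
Proof.
move=> H; rewrite le_eqVlt => /orP[/eqP D0|D0].
  rewrite -D0 mul0r; have [->|X0] := eqVneq X 0; first by rewrite expr0n.
  (* Where D = 0 the hypothesis bounds a linear function of t. *)
  have := H ((F + 1) / (2 * X)); rewrite -D0 mulr0 add0r.
  have -> : 2 * ((F + 1) / (2 * X)) * X = F + 1 by field; rewrite X0.
  lra.
have := H (X / D).
have -> : 2 * (X / D) * X = (2 * X ^+ 2) / D by field; lra.
have -> : (X / D) ^+ 2 * D + F = (X ^+ 2 + D * F) / D by field; lra.
by rewrite ler_pM2r ?invr_gt0 //; lra.
Qed.

Lemma mediant_le (R : realDomainType) (mu E1 E2 N1 N2 : R) :
  0 <= E1 -> 0 <= E2 -> 0 <= N1 -> 0 <= N2 ->
  0 < N1 + N2 -> E1 + E2 <= mu * (N1 + N2) ->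
  0 < N1 /\ E1 <= mu * N1 \/ 0 < N2 /\ E2 <= mu * N2.
Proof.
move=> E10 E20; rewrite le_eqVlt => /orP[/eqP <-|N10].
  by rewrite !add0r => _ N20 H; right; split=> //; lra.
rewrite le_eqVlt => /orP[/eqP <-|N20] _ H; first by left; split=> //; lra.
have [|H1] := leP E1 (mu * N1); first by left.
by right; split=> //; lra.
Qed.

(** * Quadratic forms of a weighted graph with killing *)

Section WeightedForms.
Variables (R : rcfType) (V : finType).
Implicit Types (A : V -> V -> R) (b c d g : V -> R) (S U : {set V}).

Lemma sum_indicator (x : V -> R) S :
  \sum_i x i * (i \in S)%:R = \sum_(i in S) x i.
Proof.
rewrite [RHS]big_mkcond; apply: eq_bigr => i _.
by case: ifP => _; rewrite ?mulr1 ?mulr0.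
Qed.

(** The functional is additive along the layers of g: subtracting from g its
    least positive value m on its support S subtracts m times the value at the
    indicator of S, and shrinks the support.  This replaces the integral over
    level sets. *)
Lemma coarea A c U :
  (forall S, S \subset U ->
    0 <= \sum_i \sum_j A i j * `|(i \in S)%:R - (j \in S)%:R|
         + \sum_(i in S) c i) ->
  forall g, (forall i, 0 <= g i) -> (forall i, g i != 0 -> i \in U) ->
  0 <= \sum_i \sum_j A i j * `|g i - g j| + \sum_i c i * g i.
Proof.
move=> H g; have [k] := ubnP #|[set i | g i != 0]|.
elim: k g => // k IH g; set S := [set i | _] => leS g0 gU.
have inS i : (i \in S) = (g i != 0) by rewrite /S inE.
have [S0|[i0 i0S]] := set_0Vmem S.
  have gz i : g i = 0.
    by move/setP/(_ i): S0; rewrite inS inE => /negbFE/eqP.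
  rewrite big1 ?add0r ?big1 // => i _; rewrite ?gz ?mulr0 //.
  by rewrite big1 // => j _; rewrite !gz subrr normr0 mulr0.
have [i1 i1S min1] := arg_minP g i0S.
have {}i1S : i1 \in S by [].
pose m := g i1.
have m0 : 0 < m by rewrite lt_def g0 andbT -inS.
pose g' i := g i - m * (i \in S)%:R.
have g'0 i : 0 <= g' i.
  rewrite /g'; case: (boolP (i \in S)) => iS; rewrite ?mulr0 ?subr0 //.
  by rewrite mulr1 subr_ge0 min1.
have gE i : i \notin S -> g i = 0 by rewrite inS negbK => /eqP.
have g'S i : g' i != 0 -> i \in S.
  by apply: contraNT => iS; rewrite /g' gE // (negPf iS) mulr0 subr0.
have {}IH : 0 <= \sum_i \sum_j A i j * `|g' i - g' j| + \sum_i c i * g' i.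
  apply: IH => // [|i]; last by move/(g'S i); rewrite inS; apply: gU.
  rewrite ltnS in leS; apply: leq_trans leS.
  apply: proper_card; apply/properP; split.
    by apply/subsetP=> i; rewrite inE; apply: g'S.
  by exists i1; rewrite // inE negbK /g' i1S mulr1 subrr.
have SU : S \subset U by apply/subsetP => i; rewrite inS; apply: gU.
have := H S SU; rewrite -sum_indicator => /(mulr_ge0 (ltW m0)).
rewrite mulrDr !mulr_sumr; move=> /(addr_ge0 IH); rewrite addrACA.
have eq_ge0 (x y : R) : x = y -> 0 <= x -> 0 <= y by move=> ->.
apply: eq_ge0; congr (_ + _); rewrite -big_split;
  apply: eq_bigr => i _ /=; last by rewrite /g'; ring.
rewrite mulr_sumr -big_split; apply: eq_bigr => j _ /=.
rewrite mulrCA -mulrDr; congr (_ * _).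
have g'i := g'0 i; have g'j := g'0 j; move: g'i g'j; rewrite /g'.
case: (boolP (i \in S)) => iS; case: (boolP (j \in S)) => jS;
  rewrite ?(gE _ iS) ?(gE _ jS) ?mulr1 ?mulr0 ?subr0 ?sub0r ?subrr ?normr0 ?normrN ?normr1
    ?mulr0 ?mulr1 ?addr0 //.
- by move=> _ _; rewrite opprB addrA subrK.
- by move=> ? _; rewrite !ger0_norm // subrK.
- by move=> _ ?; rewrite !ger0_norm // subrK.
Qed.

(** The vector d is kept apart from the weight because a form with killing is
    compared with the degrees of the weight it was split from. *)
Definition mass d g : R := \sum_i d i * g i ^+ 2.

(** The sum runs over ordered pairs, hence the factor 1/2; b is a killing rate,
    equivalently the weight of an edge to an extra vertex where g is 0. *)
Definition dform A b g : R :=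
  2^-1 * (\sum_i \sum_j A i j * (g i - g j) ^+ 2) + \sum_i b i * g i ^+ 2.

(** The companion of [dform] from the signless Laplacian. *)
Definition qform A b g : R :=
  2^-1 * (\sum_i \sum_j A i j * (g i + g j) ^+ 2) + \sum_i b i * g i ^+ 2.

Lemma mass_ext (d1 d2 : V -> R) g : d1 =1 d2 -> mass d1 g = mass d2 g.
Proof. by move=> e; apply: eq_bigr => i _; rewrite e. Qed.

Lemma sum_sym A (x : V -> R) : (forall i j, A i j = A j i) ->
  \sum_i \sum_j A i j * x j = \sum_i indeg A i * x i.
Proof.
move=> symA; rewrite exchange_big; apply: eq_bigr => i _.
by rewrite mulr_suml; apply: eq_bigr => j _; rewrite symA.
Qed.

Lemma dform_qform A b g : (forall i j, A i j = A j i) ->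
  dform A b g + qform A b g = 2 * mass (fun i => indeg A i + b i) g.
Proof.
move=> symA.
have E : \sum_i \sum_j A i j * (g i - g j) ^+ 2
       + \sum_i \sum_j A i j * (g i + g j) ^+ 2
       = 4 * \sum_i indeg A i * g i ^+ 2.
  have -> : 4 * \sum_i indeg A i * g i ^+ 2 =
     2 * (\sum_i \sum_j A i j * g i ^+ 2 + \sum_i \sum_j A i j * g j ^+ 2).
    rewrite (sum_sym (fun j => g j ^+ 2) symA).
    under [X in 2 * (X + _)]eq_bigr do rewrite -mulr_suml.
    by rewrite /indeg; ring.
  rewrite -!big_split mulr_sumr; apply: eq_bigr => i _ /=.
  rewrite -!big_split mulr_sumr; apply: eq_bigr => j _ /=; ring.
have M : mass (fun i => indeg A i + b i) g
       = \sum_i indeg A i * g i ^+ 2 + \sum_i b i * g i ^+ 2.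
  by rewrite -big_split; apply: eq_bigr => i _; rewrite mulrDl.
rewrite /dform /qform M; lra.
Qed.

Lemma dform_ge0 A b g : (forall i j, 0 <= A i j) -> (forall i, 0 <= b i) ->
  0 <= dform A b g.
Proof.
move=> A0 b0; apply: addr_ge0; last first.
  by apply: sumr_ge0 => i _; rewrite mulr_ge0 ?sqr_ge0.
rewrite mulr_ge0 ?invr_ge0 //; apply: sumr_ge0 => i _; apply: sumr_ge0 => j _.
by rewrite mulr_ge0 ?sqr_ge0.
Qed.

Lemma qform_ge0 A b g : (forall i j, 0 <= A i j) -> (forall i, 0 <= b i) ->
  0 <= qform A b g.
Proof.
move=> A0 b0; apply: addr_ge0; last first.
  by apply: sumr_ge0 => i _; rewrite mulr_ge0 ?sqr_ge0.
rewrite mulr_ge0 ?invr_ge0 //; apply: sumr_ge0 => i _; apply: sumr_ge0 => j _.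
by rewrite mulr_ge0 ?sqr_ge0.
Qed.

Lemma mass_ge0 d g : (forall i, 0 <= d i) -> 0 <= mass d g.
Proof. by move=> d0; apply: sumr_ge0 => i _; rewrite mulr_ge0 ?sqr_ge0. Qed.

Lemma dformE A g : (forall i j, A i j = A j i) ->
  dform A (fun=> 0) g = mass (indeg A) g - \sum_i \sum_j A i j * (g i * g j).
Proof.
move=> symA; rewrite /dform [X in _ + X]big1 => [|i _]; last by rewrite mul0r.
have -> : mass (indeg A) g
   = 2^-1 * (\sum_i \sum_j A i j * g i ^+ 2 + \sum_i \sum_j A i j * g j ^+ 2).
  rewrite (sum_sym (fun j => g j ^+ 2) symA).
  under [X in _ * (X + _)]eq_bigr do rewrite -mulr_suml.
  by rewrite /mass /indeg; lra.
rewrite addr0 -[X in _ - X](mulKf (x := 2)) ?pnatr_eq0 // -mulrBr; congr (_ * _).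
rewrite mulr_sumr -big_split -sumrB; apply: eq_bigr => i _ /=.
rewrite mulr_sumr -big_split -sumrB; apply: eq_bigr => j _ /=; ring.
Qed.

Lemma sum_boundary A S : (forall i j, A i j = A j i) ->
  \sum_i \sum_j A i j * `|(i \in S)%:R - (j \in S)%:R|
  = 2 * edge_weight A S (~: S).
Proof.
move=> symA.
have E : \sum_i \sum_j A i j * ((i \in S)%:R * (j \in ~: S)%:R)
       = edge_weight A S (~: S).
  rewrite /edge_weight -sum_indicator; apply: eq_bigr => i _.
  by rewrite -sum_indicator mulr_suml; apply: eq_bigr => j _; ring.
rewrite mulr2n mulrDl mul1r -{1}E -E [X in _ = _ + X]exchange_big -big_split.
apply: eq_bigr => i _; rewrite -big_split; apply: eq_bigr => j _ /=.
rewrite (symA j i) -mulrDr !inE.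
case: (i \in S); case: (j \in S) => /=;
  by rewrite ?subrr ?subr0 ?sub0r ?normrN ?normr0 ?normr1; ring.
Qed.

(** Cheeger's inequality for a Dirichlet problem.  With X the coarea sum of
    g^2, k N <= X and X^2 <= D (2 N - D), that is (N - D)^2 <= (1 - k^2) N^2;
    for mu < 1 the left side is at least (1 - mu)^2 N^2. *)
Lemma cheeger_dirichlet A b (k mu : R) U g :
    (forall i j, A i j = A j i) ->
    (forall i j, 0 <= A i j) -> (forall i, 0 <= b i) -> 0 <= k ->
    (forall S, S \subset U ->
      k * \sum_(i in S) (indeg A i + b i)
        <= edge_weight A S (~: S) + \sum_(i in S) b i) ->
    (forall i, g i != 0 -> i \in U) ->
    0 < mass (fun i => indeg A i + b i) g ->
    dform A b g <= mu * mass (fun i => indeg A i + b i) g ->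
  1 - Num.sqrt (1 - k ^+ 2) <= mu.
Proof.
move=> symA A0 b0 k0 kS gU; set N := mass _ g; set D := dform A b g => N0 DN.
pose X := 2^-1 * (\sum_i \sum_j A i j * `|g i ^+ 2 - g j ^+ 2|)
          + \sum_i b i * g i ^+ 2.
have kX : k * N <= X.
  pose c i := 2 * (b i - k * (indeg A i + b i)).
  have := @coarea A c U _ (fun i => g i ^+ 2).
  have cE (x : V -> R) : \sum_i c i * x i
      = 2 * (\sum_i b i * x i) - 2 * (k * \sum_i (indeg A i + b i) * x i).
    rewrite !mulr_sumr -sumrB; apply: eq_bigr => i _; rewrite /c; ring.
  rewrite cE -/N /X => H; suff: 0 <= 2 * (X - k * N) by rewrite /X; lra.
  rewrite /X; apply: le_trans (H _ _ _) _ => //; last by rewrite /N /mass; lra.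
  - move=> S SU; rewrite sum_boundary // -sum_indicator cE !sum_indicator.
    have := kS S SU; lra.
  - by move=> i; rewrite sqr_ge0.
  - by move=> i; rewrite sqrf_eq0; apply: gU.
have DF : D + qform A b g = 2 * N by apply: dform_qform.
have X2 : X ^+ 2 <= D * qform A b g.
  apply: quadratic_bound; last exact: dform_ge0.
  move=> t; rewrite /D /qform /dform /X.
  have H1 : 2 * t * (\sum_i \sum_j A i j * `|g i ^+ 2 - g j ^+ 2|)
     <= t ^+ 2 * (\sum_i \sum_j A i j * (g i - g j) ^+ 2)
        + \sum_i \sum_j A i j * (g i + g j) ^+ 2.
    rewrite !mulr_sumr -big_split; apply: ler_sum => i _ /=.
    rewrite !mulr_sumr -big_split; apply: ler_sum => j _ /=.
    rewrite mulrCA (mulrCA (t ^+ 2)) -mulrDr; apply: ler_wpM2l => //.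
    rewrite subr_sqr normrM -(real_normK (num_real (g i - g j))).
    rewrite -(real_normK (num_real (g i + g j))).
    have := sqr_ge0 (t * `|g i - g j| - `|g i + g j|); lra.
  have H2 : 2 * t * (\sum_i b i * g i ^+ 2)
     <= t ^+ 2 * (\sum_i b i * g i ^+ 2) + \sum_i b i * g i ^+ 2.
    have := mulr_ge0 (sqr_ge0 (t - 1)) (mass_ge0 g b0); rewrite /mass; lra.
  lra.
have [mu1|mu1] := leP 1 mu.
  by rewrite (le_trans _ mu1) // lerBlDr lerDl sqrtr_ge0.
suff: 1 - mu <= Num.sqrt (1 - k ^+ 2) by lra.
have kN2 : (k * N) ^+ 2 <= X ^+ 2.
  have kN0 : 0 <= k * N by rewrite mulr_ge0 // ltW.
  by rewrite ler_sqr ?nnegrE // (le_trans kN0).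
have ND : ((1 - mu) * N) ^+ 2 <= (N - D) ^+ 2.
  have h : 0 <= (1 - mu) * N by rewrite mulr_ge0 ?ltW // subr_gt0.
  by rewrite ler_sqr ?nnegrE //; lra.
rewrite -[leLHS]gtr0_norm ?subr_gt0 // -sqrtr_sqr ler_wsqrtr //.
rewrite -(ler_pM2r (exprn_gt0 2 N0)) -exprMn (le_trans ND) //.
have qE : qform A b g = 2 * N - D by lra.
rewrite qE in X2; lra.
Qed.

End WeightedForms.

(** * Cheeger and dual Cheeger inequalities *)

Section Bounds.
Variables (R : rcfType) (V : finType) (W : V -> V -> R).
Implicit Types (f g : V -> R) (S U : {set V}).
Hypotheses (symW : forall i j, W i j = W j i) (W0 : forall i j, 0 <= W i j).
Hypothesis (d0 : forall i, 0 < indeg W i).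

Let d := indeg W.

Lemma vol_ge0 S : 0 <= vol W S.
Proof. by apply: sumr_ge0 => i _; apply: ltW. Qed.

Lemma vol_gt0 S : S != set0 -> 0 < vol W S.
Proof.
move=> /set0Pn[i iS]; rewrite /vol (bigD1 i) //= ltr_pwDl ?d0 //.
by apply: sumr_ge0 => j _; apply: ltW.
Qed.

Lemma volC S : vol W S + vol W (~: S) = vol W setT.
Proof.
rewrite /vol !(bigID (fun i => i \in S) [in setT]) /=.
by congr (_ + _); apply: eq_bigl => i; rewrite !inE.
Qed.

Lemma edge_weight_ge0 S U : 0 <= edge_weight W S U.
Proof. by apply: sumr_ge0 => i _; apply: sumr_ge0. Qed.

Lemma edge_weightC S U : edge_weight W S U = edge_weight W U S.
Proof.
rewrite /edge_weight exchange_big; apply: eq_bigr => i _.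
by apply: eq_bigr => j _; apply: symW.
Qed.

Lemma edge_weight_le_vol S U : edge_weight W S U <= vol W S.
Proof.
apply: ler_sum => i _; rewrite /indeg [leRHS](bigID (fun j => j \in U)) /=.
by rewrite lerDl sumr_ge0.
Qed.

Lemma cheeger_ge0 : 0 <= cheeger W.
Proof.
rewrite /cheeger; set s := map _ _; have [->|s0] := eqVneq s [::].
  by rewrite /seq_min big_nil.
apply: le_seq_min => // x /mapP[S _ ->]; apply: divr_ge0.
  exact: edge_weight_ge0.
by rewrite le_min !vol_ge0.
Qed.

(** On sets of at most half of the volume the minimum in the Cheeger quotient
    is the volume of the set itself. *)
Lemma cheeger_mul_vol_le S : 2 * vol W S <= vol W setT ->
  cheeger W * vol W S <= edge_weight W S (~: S).
Proof.
move=> S2; have [->|S0] := eqVneq S set0.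
  by rewrite /vol big_set0 mulr0 edge_weight_ge0.
have vS := vol_gt0 S0; have vC := volC S.
rewrite -ler_pdivlMr // /cheeger.
have -> : vol W S = Num.min (vol W S) (vol W (~: S)) by rewrite min_l //; lra.
apply: seq_min_le; apply/mapP; exists S => //.
rewrite mem_filter S0 mem_enum andbT; apply/eqP => C0.
by move: vC; rewrite C0 /vol big_set0; rewrite /vol in vS S2 *; lra.
Qed.

Let zero : V -> R := fun=> 0.

Lemma cheeger_half g U mu : 2 * vol W U <= vol W setT ->
  (forall i, g i != 0 -> i \in U) ->
  0 < mass d g -> dform W zero g <= mu * mass d g ->
  1 - Num.sqrt (1 - cheeger W ^+ 2) <= mu.
Proof.
move=> U2 gU.
rewrite -(@mass_ext R V (fun i => indeg W i + zero i)) => [N0 DN|i]; last exact: addr0.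
apply: (cheeger_dirichlet symW W0 _ cheeger_ge0 _ gU N0 DN) => // S SU.
rewrite (eq_bigr (indeg W)) => [|i _]; last exact: addr0.
rewrite big1_eq addr0; apply: cheeger_mul_vol_le; apply: le_trans U2.
rewrite ler_pM2l // /vol [leRHS](big_setID S) /= (setIidPr SU) lerDl.
by apply: sumr_ge0 => i _; apply: ltW.
Qed.

(** The least value of f above which lies at most half of the volume: the next
    smaller value fails this test, which bounds the volume below. *)
Lemma weighted_median f : (0 < #|V|)%N -> exists c,
  2 * vol W [set i | c < f i] <= vol W setT
  /\ 2 * vol W [set i | f i < c] <= vol W setT.
Proof.
move=> /card_gt0P[k _].
pose P i := 2 * vol W [set j | f i < f j] <= vol W setT.
have [m _ maxm] := @arg_maxP _ _ _ k predT f isT.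
have Pm : P m.
  rewrite /P (_ : [set j | _] = set0) ?[vol _ set0]big_set0 ?mulr0 ?vol_ge0 //.
  by apply/setP => j; rewrite !inE; apply/negbTE; rewrite -leNgt; apply: maxm.
have [i Pi mini] := arg_minP f Pm.
exists (f i); split=> //.
have [->|/set0Pn[k0 k0L]] := eqVneq [set j | f j < f i] set0.
  by rewrite [vol _ set0]big_set0 mulr0 vol_ge0.
have [l lL maxl] := arg_maxP f k0L.
have {}lL : f l < f i.
  have : l \in [set j | f j < f i] by [].
  by rewrite inE.
have : ~~ P l by apply/negP => /mini; rewrite leNgt lL.
rewrite /P -ltNge; have := volC [set j | f j < f i].
have -> : ~: [set j | f j < f i] = [set j | f l < f j].
  apply/setP => j; rewrite !inE -leNgt; apply/idP/idP => [|lj].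
    exact: lt_le_trans.
  rewrite leNgt; apply/negP => ji.
  have /maxl : j \in [set j | f j < f i] by rewrite inE.
  by move/(lt_le_trans lj); rewrite ltxx.
lra.
Qed.

(** Shifting by a median c leaves the form unchanged and, by orthogonality to
    the constants, does not decrease the mass; splitting f - c into positive and
    negative parts adds up masses and does not increase the form, so one of the
    two parts keeps the bound on the Rayleigh quotient. *)
Lemma cheeger_bound f mu : (0 < #|V|)%N -> \sum_i d i * f i = 0 ->
  0 < mass d f -> dform W zero f <= mu * mass d f ->
  1 - Num.sqrt (1 - cheeger W ^+ 2) <= mu.
Proof.
move=> V0 df0 N0 DN; have [c [c1 c2]] := weighted_median f V0.
pose gp i := Num.max (f i - c) 0; pose gm i := Num.max (c - f i) 0.
have E : dform W zero gp + dform W zero gm <= dform W zero f.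
  rewrite /dform !(big1 _ _ (fun i => zero i * _)); last 3 first.
  - by move=> i _; rewrite mul0r.
  - by move=> i _; rewrite mul0r.
  - by move=> i _; rewrite mul0r.
  rewrite !addr0 -mulrDr ler_pM2l ?invr_gt0 // -big_split.
  apply: ler_sum => i _; rewrite -big_split; apply: ler_sum => j _ /=.
  rewrite -mulrDr; apply: ler_wpM2l => //; rewrite /gp /gm.
  case: (leP (f i - c) 0); case: (leP (f j - c) 0); case: (leP (c - f i) 0);
    case: (leP (c - f j) 0) => *; try lra; nra.
have N : mass d gp + mass d gm = mass d f + c ^+ 2 * vol W setT.
  have -> : mass d f + c ^+ 2 * vol W setT =
     mass d f - 2 * c * (\sum_i d i * f i) + c ^+ 2 * (\sum_i d i).
    rewrite df0 mulr0 subr0; congr (_ + _ * _).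
    by apply: eq_bigl => i; rewrite inE.
  rewrite !mulr_sumr -sumrB -!big_split; apply: eq_bigr => i _ /=.
  rewrite /gp /gm; case: (leP (f i - c) 0); case: (leP (c - f i) 0) => *; try lra.
  have -> : f i = c by lra.
  ring.
have D0 g : 0 <= dform W zero g by apply: dform_ge0 => // i; exact: lexx.
have M0 g : 0 <= mass d g by apply: mass_ge0 => i; apply: ltW.
have cN : 0 <= c ^+ 2 * vol W setT by rewrite mulr_ge0 ?sqr_ge0 ?vol_ge0.
have mu0 : 0 <= mu by rewrite -(pmulr_lge0 _ N0) (le_trans (D0 f)).
case: (@mediant_le R mu _ _ _ _ (D0 gp) (D0 gm) (M0 gp) (M0 gm)).
- by rewrite N; lra.
- by rewrite N mulrDr; have := mulr_ge0 mu0 cN; lra.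
- case=> Np Dp; apply: (cheeger_half c1 _ Np Dp) => i.
  by rewrite inE /gp; case: (leP (f i - c) 0) => //; rewrite ?eqxx // subr_gt0.
- case=> Np Dp; apply: (cheeger_half c2 _ Np Dp) => i.
  by rewrite inE /gm; case: (leP (c - f i) 0) => //; rewrite ?eqxx // subr_gt0.
Qed.

(** The dual Cheeger constant ranges over pairs of nonempty sets, but an empty
    set makes the left side vanish, and two singletons show that the constant is
    nonnegative. *)
Lemma edge_weight_le_dual_cheeger S (T : {set V}) : [disjoint S & T] ->
  (1 < #|V|)%N ->
  2 * edge_weight W S T <= dual_cheeger W * (vol W S + vol W T).
Proof.
move=> ST V2.
have mem (A B : {set V}) : A != set0 -> B != set0 -> [disjoint A & B] ->
    2 * edge_weight W A B / (vol W A + vol W B) <= dual_cheeger W.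
  move=> A0 B0 AB; apply: le_seq_max; apply/mapP; exists (A, B) => //.
  by rewrite mem_filter /= A0 B0 AB mem_enum.
have hb0 : 0 <= dual_cheeger W.
  have [x [y [_ _ xy]]] := card_gt1P V2.
  apply: le_trans (mem [set x] [set y] _ _ _).
  - by rewrite divr_ge0 ?addr_ge0 ?vol_ge0 ?mulr_ge0 ?edge_weight_ge0.
  - by apply/set0Pn; exists x; rewrite inE.
  - by apply/set0Pn; exists y; rewrite inE.
  - by rewrite disjoints1 inE.
have RHS0 : 0 <= dual_cheeger W * (vol W S + vol W T).
  by rewrite mulr_ge0 ?addr_ge0 ?vol_ge0.
have [S0|S0] := eqVneq S set0.
  by rewrite {1}S0 /edge_weight big_set0 mulr0.
have [T0|T0] := eqVneq T set0.
  by rewrite {1}T0 edge_weightC /edge_weight big_set0 mulr0.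
rewrite -ler_pdivrMr; first exact: mem.
by rewrite addr_gt0 ?vol_gt0.
Qed.

Lemma dual_cheeger_le1 : dual_cheeger W <= 1.
Proof.
rewrite /dual_cheeger; set s := map _ _; have [->|s0] := eqVneq s [::].
  by rewrite /seq_max big_nil.
apply: seq_max_le => // x /mapP[[S T]]; rewrite mem_filter /=.
case/andP=> /and3P[S0 T0 _] _ ->.
rewrite ler_pdivrMr ?addr_gt0 ?vol_gt0 // mul1r.
have := edge_weight_le_vol S T; have := edge_weight_le_vol T S.
rewrite (edge_weightC T S); lra.
Qed.

(** For a same-sign edge (f_i + f_j)^2 >= f_i^2 + f_j^2, the form of two
    killing terms; for the other edges (f_i + f_j)^2 = (|f_i| - |f_j|)^2.  So
    the signless form of f dominates the Dirichlet form with killing of |f|. *)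
Lemma dual_cheeger_bound f mu : (1 < #|V|)%N -> 0 < mass d f ->
  qform W zero f <= mu * mass d f ->
  1 - Num.sqrt (1 - (1 - dual_cheeger W) ^+ 2) <= mu.
Proof.
move=> V2 N0 QN.
pose same i j := 0 < f i * f j.
pose A i j := W i j * (~~ same i j)%:R.
pose b i := \sum_j W i j * (same i j)%:R.
have sameC i j : same i j = same j i by rewrite /same mulrC.
have symA i j : A i j = A j i by rewrite /A symW sameC.
have A0 i j : 0 <= A i j by rewrite mulr_ge0 ?ler0n.
have b0 i : 0 <= b i by apply: sumr_ge0 => j _; rewrite mulr_ge0 ?ler0n.
have dE i : indeg A i + b i = d i.
  rewrite -big_split; apply: eq_bigr => j _; rewrite /A /=.
  by case: (same i j); rewrite /= !(mulr0, mulr1) ?add0r ?addr0.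
pose g i : R := `|f i|.
have NE : mass (fun i => indeg A i + b i) g = mass d f.
  by apply: eq_bigr => i _; rewrite dE real_normK ?num_real.
apply: (@cheeger_dirichlet R V A b _ mu [set i | f i != 0] g) => //.
- by rewrite subr_ge0 dual_cheeger_le1.
- move=> S SU; pose P := [set i in S | 0 < f i]; pose Q := [set i in S | f i < 0].
  have PQ : [disjoint P & Q].
    rewrite -setI_eq0; apply/eqP/setP => i; rewrite !inE.
    by case: (ltgtP (f i) 0); rewrite ?andbF.
  have := edge_weight_le_dual_cheeger PQ V2.
  have SPQ (x : V -> R) : \sum_(i in S) x i = \sum_(i in P) x i + \sum_(i in Q) x i.
    rewrite (bigID (fun i => 0 < f i)) /=; congr (_ + _); apply: eq_bigl => i.
      by rewrite inE.
    rewrite inE; case: (boolP (i \in S)) => //= iS.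
    have := subsetP SU i iS; rewrite inE; by case: ltgtP.
  have -> : vol W P + vol W Q = \sum_(i in S) (indeg A i + b i).
    by rewrite SPQ; congr (_ + _); apply: eq_bigr => i _; rewrite dE.
  have AS : \sum_(i in S) indeg A i = edge_weight A S S + edge_weight A S (~: S).
    rewrite -big_split; apply: eq_bigr => i _.
    rewrite /indeg (bigID (fun j => j \in S)) /=; congr (_ + _).
    by apply: eq_bigl => j; rewrite inE.
  (* Edges kept in A and inside S join P to Q, and are counted in both orders. *)
  have -> : 2 * edge_weight W P Q = edge_weight A S S.
    have EA (P1 P2 : {set V}) (z : bool) :
        (forall i j, i \in P1 -> j \in P2 -> same i j = ~~ z) ->
        \sum_(i in P1) \sum_(j in P2) A i j = edge_weight W P1 P2 * z%:R.
      move=> H; rewrite mulr_suml; apply: eq_bigr => i iP.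
      by rewrite mulr_suml; apply: eq_bigr => j jP; rewrite /A H // negbK.
    rewrite /edge_weight SPQ.
    under [X in _ = X + _]eq_bigr do rewrite SPQ.
    under [X in _ = _ + X]eq_bigr do rewrite SPQ.
    rewrite !big_split /= (EA P P false) ?(EA P Q true) ?(EA Q P true) ?(EA Q Q false).
    + by rewrite (edge_weightC Q P) /edge_weight !(mulr0, mulr1); ring.
    + by move=> i j; rewrite !inE /same => /andP[_ ?] /andP[_ ?]; rewrite nmulr_rgt0.
    + move=> i j; rewrite !inE /same => /andP[_ ?] /andP[_ ?].
      by rewrite nmulr_rgt0 // ltNge ltW.
    + move=> i j; rewrite !inE /same => /andP[_ ?] /andP[_ ?].
      by rewrite pmulr_rgt0 // ltNge ltW.
    + by move=> i j; rewrite !inE /same => /andP[_ ?] /andP[_ ?]; rewrite pmulr_rgt0.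
  rewrite mulrBl mul1r {2}big_split /= AS => H; lra.
- by move=> i; rewrite inE normr_eq0.
- by rewrite NE.
rewrite NE; apply: le_trans QN; rewrite /dform /qform.
rewrite [X in _ <= _ + X]big1 => [|i _]; last by rewrite mul0r.
have -> : \sum_i b i * g i ^+ 2
   = 2^-1 * \sum_i \sum_j W i j * (same i j)%:R * (f i ^+ 2 + f j ^+ 2).
  pose B i j := W i j * (same i j)%:R.
  have symB i j : B i j = B j i by rewrite /B symW sameC.
  have := sum_sym (fun j => f j ^+ 2) symB => HB.
  under [X in _ = _ * X]eq_bigr do under eq_bigr do rewrite mulrDr.
  under [X in _ = _ * X]eq_bigr do rewrite big_split /= -mulr_suml.
  rewrite big_split /= HB /indeg.
  under eq_bigr do rewrite /g real_normK ?num_real //.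
  by rewrite /b /B; lra.
rewrite addr0 -mulrDr ler_pM2l ?invr_gt0 // -big_split; apply: ler_sum => i _.
rewrite -big_split; apply: ler_sum => j _ /=; rewrite /A -!mulrA -mulrDr.
apply: ler_wpM2l => //; rewrite /same /g.
case: ltP => /= fij; rewrite !(mul0r, mul1r) ?add0r ?addr0; first by lra.
rewrite sqrrB sqrrD !real_normK ?num_real // lerD2r lerD2l -mulNrn lerMn2r /=.
by rewrite -normrM ler0_norm // opprK.
Qed.

End Bounds.

(** * The directed Laplacian and its symmetrization *)

Section Spectrum.
Variables (R : rcfType) (V : finType) (w : V -> V -> R) (phi : V -> R).
Hypotheses (hV : (2 <= #|V|)%N) (hw : forall i j, 0 <= w i j).
Hypotheses (hconn : strongly_connected w) (hphi : perron_vector w phi).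

Let W := sym_weight w phi.
Let P i j := w i j / indeg w i.

(** A path from another vertex ends with an edge into i. *)
Lemma indeg_gt0 i : 0 < indeg w i.
Proof.
have [j ji] : exists j, j != i.
  have [x [y [_ _ xy]]] := card_gt1P hV.
  by have [xi|xi] := eqVneq x i; [exists y; rewrite -xi eq_sym | exists x].
have [k wik] : exists k, w i k != 0.
  have [/connectP[p]] := hconn ji.
  case: (lastP p) => [_ /esym/eqP|q k]; first by rewrite /= (negPf ji).
  rewrite rcons_path last_rcons => /andP[_ ek] ->.
  by exists (last j q).
rewrite /indeg (bigD1 k) //= ltr_pwDl ?sumr_ge0 //.
by rewrite lt_def wik hw.
Qed.

Lemma sum_transition i : \sum_j P i j = 1.
Proof. by rewrite -mulr_suml divff // gt_eqF ?indeg_gt0. Qed.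

Lemma sym_weightC i j : W i j = W j i.
Proof. exact: addrC. Qed.

Lemma sym_weight_ge0 i j : 0 <= W i j.
Proof.
have [phi0 _] := hphi.
by rewrite addr_ge0 // mulr_ge0 ?(ltW (phi0 _)) // divr_ge0 // ltW // indeg_gt0.
Qed.

(** The first summand has row sum phi i because P is stochastic, the second one
    because phi is stationary. *)
Lemma indeg_sym_weight i : indeg W i = 2 * phi i.
Proof.
have [_ phiP] := hphi.
by rewrite /indeg /W /sym_weight big_split /= -mulr_suml sum_transition phiP; ring.
Qed.

Lemma indeg_sym_weight_gt0 i : 0 < indeg W i.
Proof. by have [phi0 _] := hphi; rewrite indeg_sym_weight mulr_gt0. Qed.

(** The real and imaginary parts of P v = (al + i be) v with v = a + i b, tested
    against phi a and phi b: the terms in be cancel, and the symmetric part of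
    phi i * P i j is W i j / 2. *)
Lemma dform_eigen (a b : V -> R) (al be : R) :
  (forall i, \sum_j P i j * a j = al * a i - be * b i) ->
  (forall i, \sum_j P i j * b j = al * b i + be * a i) ->
  dform W (fun=> 0) a + dform W (fun=> 0) b
  = (1 - al) * (mass (indeg W) a + mass (indeg W) b).
Proof.
move=> Pa Pb; rewrite !dformE; try exact: sym_weightC.
have cross (g : V -> R) : \sum_i \sum_j W i j * (g i * g j)
    = \sum_i 2 * phi i * g i * \sum_j P i j * g j.
  rewrite /W /sym_weight.
  under eq_bigr do under eq_bigr do rewrite mulrDl.
  under eq_bigr do rewrite big_split /=.
  rewrite big_split /= [X in _ + X]exchange_big /= -big_split.
  apply: eq_bigr => i _; rewrite /= -big_split mulr_sumr.
  by apply: eq_bigr => j _; rewrite /P /=; ring.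
suff E : \sum_i \sum_j W i j * (a i * a j) + \sum_i \sum_j W i j * (b i * b j)
   = al * (mass (indeg W) a + mass (indeg W) b).
  by rewrite mulrBl mul1r -E; ring.
rewrite !cross -!big_split mulr_sumr; apply: eq_bigr => i _ /=.
by rewrite Pa Pb indeg_sym_weight; ring.
Qed.

Lemma Re_sum (s : V -> R) (v : V -> R[i]) :
  complex.Re (\sum_y (s y)%:C * v y) = \sum_y s y * complex.Re (v y).
Proof.
rewrite (big_morph _ (id1 := 0) (op1 := +%R)) //; last by case=> ? ? [].
by apply: eq_bigr => y _; case: (v y) => x z; rewrite /= mul0r subr0.
Qed.

Lemma Im_sum (s : V -> R) (v : V -> R[i]) :
  complex.Im (\sum_y (s y)%:C * v y) = \sum_y s y * complex.Im (v y).
Proof.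
rewrite (big_morph _ (id1 := 0) (op1 := +%R)) //; last by case=> ? ? [].
by apply: eq_bigr => y _; case: (v y) => x z; rewrite /= mul0r addr0.
Qed.

Lemma mul_laplace_mx (u : 'cV[R[i]]_#|V|) i :
  (laplace_mx w *m u) (enum_rank i) 0
  = u (enum_rank i) 0 - \sum_j (P i j)%:C * u (enum_rank j) 0.
Proof.
rewrite mxE; pose v j := u (enum_rank j) 0.
transitivity (\sum_j ((i == j)%:R - (P i j)%:C) * v j).
  rewrite [RHS](big_enum_val (A := predT)) /=.
  apply: eq_bigr => k _; rewrite /v enum_valK mxE ffunE !enum_rankK ifT; last first.
    by rewrite gt_eqF ?indeg_gt0.
  congr ((_ - _) * _); first by rewrite ffunE.
  rewrite (bigD1 (enum_val k)) //= big1 => [|j jk]; last first.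
    by rewrite ffunE (negPf jk) mulr0.
  by rewrite ffunE eqxx mulr1 addr0 /P rmorphM fmorphV mulrC.
under eq_bigr do rewrite mulrBl.
rewrite sumrB; congr (_ - _); rewrite (bigD1 i) //= eqxx mul1r big1 ?addr0 //.
by move=> j; rewrite eq_sym => /negPf ->; rewrite mul0r.
Qed.

Variable lam : nat -> R[i].
Hypothesis hlam : laplace_eigenvalues w lam.

(** Pairing the eigenvalue equation with phi gives the orthogonality only where
    lam k is not 0; deflation gives it for every k > 0. *)
Lemma laplace_eigenfunction k : (0 < k < #|V|)%N ->
  exists v : V -> R[i], [/\ exists i, v i != 0,
    forall i, \sum_j (P i j)%:C * v j = (1 - lam k) * v i
    & \sum_i (phi i)%:C * v i = 0].
Proof.
move=> /andP[k0 kV]; have [phi0 phiP] := hphi; have [charE lam0] := hlam.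
have [i0 _] : exists i : V, i \in V by apply/card_gt0P; apply: ltnW.
pose s := \sum_i phi i.
have s0 : s%:C != 0 :> R[i].
  rewrite fmorph_eq0 gt_eqF // /s (bigD1 i0) //= ltr_pwDl //.
  by apply: sumr_ge0 => i _; apply: ltW.
pose e : 'cV[R[i]]_#|V| := const_mx 1.
pose f : 'rV[R[i]]_#|V| := \row_j ((phi (enum_val j))%:C / s%:C).
have reidx (F : V -> R[i]) : \sum_(j < #|V|) F (enum_val j) = \sum_i F i.
  by rewrite [RHS](big_enum_val (A := predT)).
have Ae : laplace_mx w *m e = 0.
  apply/matrixP => j z; rewrite ord1 -(enum_valK j) mul_laplace_mx !mxE.
  under eq_bigr do rewrite mxE mulr1.
  by rewrite -rmorph_sum sum_transition subrr.
have fu (u : 'cV[R[i]]_#|V|) :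
    (f *m u) 0 0 = (\sum_i (phi i)%:C * u (enum_rank i) 0) / s%:C.
  rewrite mxE mulr_suml -reidx; apply: eq_bigr => j _.
  by rewrite mxE enum_valK mulrAC.
have fA : f *m laplace_mx w = 0.
  suff H u : f *m (laplace_mx w *m u) = 0 :> 'M_1.
    apply/matrixP => z j; rewrite ord1.
    have := congr1 (fun M : 'M_1 => M 0 0) (H (delta_mx j 0)).
    by rewrite mulmxA -colE !mxE.
  apply/matrixP => x y; rewrite !ord1 fu mxE.
  under eq_bigr do rewrite mul_laplace_mx mulrBr mulr_sumr.
  rewrite sumrB exchange_big /= -sumrB big1 ?mul0r // => i _.
  rewrite -{1}(phiP i) rmorph_sum mulr_suml -sumrB big1 // => j _.
  by rewrite rmorphM /P; ring.
have fe : f *m e = 1%:M.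
  apply/matrixP => x y; rewrite !ord1 fu.
  under eq_bigr do rewrite mxE mulr1.
  by rewrite -rmorph_sum mxE divff.
pose q := \prod_(1 <= i < #|V|) ('X - (lam i)%:P).
have charq : char_poly (laplace_mx w) = 'X * q.
  rewrite charE -(big_mkord predT (fun i => 'X - (lam i)%:P)) big_ltn ?(ltnW hV) //.
  by rewrite lam0 subr0.
have qk : root q (lam k).
  rewrite /q -(big_map lam predT (fun x => 'X - x%:P)) root_prod_XsubC.
  by apply: map_f; rewrite mem_index_iota k0 kV.
have [u u0 [Au fu0]] := deflated_eigenvector Ae fA fe charq qk.
exists (fun i => u (enum_rank i) 0); split.
- have /existsP[i ui] : [exists i, u (enum_rank i) 0 != 0].
    apply: contraR u0 => /existsPn H; apply/eqP/matrixP => j z.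
    by rewrite ord1 mxE -(enum_valK j); apply/eqP; rewrite -[_ == _]negbK.
  by exists i.
- move=> i; have := congr1 (fun M : 'cV_ _ => M (enum_rank i) 0) Au.
  rewrite mul_laplace_mx mxE => H; rewrite mulrBl mul1r -H; ring.
- have := fu u; rewrite fu0 mxE => /esym/eqP.
  by rewrite mulf_eq0 invr_eq0 (negPf s0) orbF => /eqP.
Qed.

Lemma laplace_Re_bounds k : (0 < k < #|V|)%N ->
  1 - Num.sqrt (1 - cheeger W ^+ 2) <= complex.Re (lam k)
  /\ complex.Re (lam k) <= 1 + Num.sqrt (1 - (1 - dual_cheeger W) ^+ 2).
Proof.
move=> /laplace_eigenfunction[v [[i0 vi0] Pv phiv]].
pose a i := complex.Re (v i); pose b i := complex.Im (v i).
pose l := complex.Re (lam k); pose m := complex.Im (lam k).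
have Pa i : \sum_j P i j * a j = (1 - l) * a i - (- m) * b i.
  rewrite -Re_sum Pv /a /b /l /m.
  by case: (v i) => ? ?; case: (lam k) => ? ? /=; rewrite sub0r.
have Pb i : \sum_j P i j * b j = (1 - l) * b i + (- m) * a i.
  rewrite -Im_sum Pv /a /b /l /m.
  by case: (v i) => ? ?; case: (lam k) => ? ? /=; rewrite sub0r.
have DD := dform_eigen Pa Pb.
have d0 := indeg_sym_weight_gt0; have W0 := sym_weight_ge0.
have symW := sym_weightC.
have M0 g : 0 <= mass (indeg W) g by apply: mass_ge0 => i; apply: ltW.
have D0 g : 0 <= dform W (fun=> 0) g by apply: dform_ge0 => // i; exact: lexx.
have Q0 g : 0 <= qform W (fun=> 0) g by apply: qform_ge0 => // i; exact: lexx.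
have N0 : 0 < mass (indeg W) a + mass (indeg W) b.
  rewrite -big_split /= (bigD1 i0) //= ltr_pwDl //.
    rewrite -mulrDr mulr_gt0 // lt_def addr_ge0 ?sqr_ge0 // andbT.
    by rewrite paddr_eq0 ?sqr_ge0 // !sqrf_eq0; move: vi0; rewrite eq_complex.
  by apply: sumr_ge0 => i _; rewrite -mulrDr mulr_ge0 ?addr_ge0 ?sqr_ge0 ?ltW.
have DQ g : dform W (fun=> 0) g + qform W (fun=> 0) g = 2 * mass (indeg W) g.
  rewrite dform_qform //; congr (_ * _).
  by apply: eq_bigr => i _; rewrite addr0.
have V0 : (0 < #|V|)%N by apply: ltnW.
have phi_a : \sum_i indeg W i * a i = 0.
  under eq_bigr do rewrite indeg_sym_weight -mulrA.
  by rewrite -mulr_sumr -Re_sum phiv mulr0.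
have phi_b : \sum_i indeg W i * b i = 0.
  under eq_bigr do rewrite indeg_sym_weight -mulrA.
  by rewrite -mulr_sumr -Im_sum phiv mulr0.
split.
  have DN : dform W (fun=> 0) a + dform W (fun=> 0) b
      <= l * (mass (indeg W) a + mass (indeg W) b) by rewrite DD; lra.
  case: (mediant_le (D0 a) (D0 b) (M0 a) (M0 b) N0 DN) => -[Ng Dg].
    exact: (cheeger_bound symW W0 d0 V0 phi_a Ng Dg).
  exact: (cheeger_bound symW W0 d0 V0 phi_b Ng Dg).
have QN : qform W (fun=> 0) a + qform W (fun=> 0) b
    <= (2 - l) * (mass (indeg W) a + mass (indeg W) b).
  have := DQ a; have := DQ b; lra.
rewrite -/l; suff: 1 - Num.sqrt (1 - (1 - dual_cheeger W) ^+ 2) <= 2 - l by lra.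
case: (mediant_le (Q0 a) (Q0 b) (M0 a) (M0 b) N0 QN) => -[Ng Qg].
  exact: (dual_cheeger_bound symW W0 d0 hV Ng Qg).
exact: (dual_cheeger_bound symW W0 d0 hV Ng Qg).
Qed.

End Spectrum.

Theorem theorem8p4 (R : rcfType) (V : finType) (w : V -> V -> R)
    (phi : V -> R) (lam : nat -> R[i])
    (hV : (2 <= #|V|)%N)
    (hw : forall i j, 0 <= w i j)
    (hconn : strongly_connected w)
    (hphi : perron_vector w phi)
    (hlam : laplace_eigenvalues w lam) :
  let h := cheeger (sym_weight w phi) in
  let hbar := dual_cheeger (sym_weight w phi) in
  let minRe := seq_min [seq complex.Re (lam i) | i <- index_iota 1 #|V|] in
  let maxRe := seq_max [seq complex.Re (lam i) | i <- index_iota 0 #|V|] in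
  [/\ 0 <= 1 - Num.sqrt (1 - h ^+ 2),
      1 - Num.sqrt (1 - h ^+ 2) <= minRe,
      minRe <= maxRe,
      maxRe <= 1 + Num.sqrt (1 - (1 - hbar) ^+ 2)
    & 1 + Num.sqrt (1 - (1 - hbar) ^+ 2) <= 2].
Proof.
move=> h hbar minRe maxRe.
have sqrt_le1 (x : R) : Num.sqrt (1 - x ^+ 2) <= 1.
  by rewrite -[leRHS]sqrtr1 ler_wsqrtr // gerBl sqr_ge0.
have bnd := laplace_Re_bounds hV hw hconn hphi hlam.
have [_ lam0] := hlam.
have mem1 : complex.Re (lam 1%N) \in [seq complex.Re (lam i) | i <- index_iota 1 #|V|].
  by apply: map_f; rewrite mem_index_iota hV.
have mem0 : complex.Re (lam 1%N) \in [seq complex.Re (lam i) | i <- index_iota 0 #|V|].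
  by apply: map_f; rewrite mem_index_iota hV.
split.
- by rewrite subr_ge0 sqrt_le1.
- apply: le_seq_min => [|x /mapP[k]]; first by apply: contraTneq mem1 => ->.
  by rewrite mem_index_iota => /bnd[? _] ->.
- exact: le_trans (seq_min_le mem1) (le_seq_max mem0).
- apply: seq_max_le => [|x /mapP[k]]; first by apply: contraTneq mem0 => ->.
  rewrite mem_index_iota => /andP[_ kV] ->; have [->|k0] := posnP k.
    by rewrite lam0 addr_ge0 ?sqrtr_ge0.
  by case: (bnd k); rewrite ?k0.
- by have := sqrt_le1 (1 - hbar); lra.
Qed.
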